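(* Let $N(\cdot)$ be a counting process with counting times $0=t_0<t_1<\cdots$, inter-arrival times $T_n=t_n-t_{n-1}$, residual time process $R(\cdot)$ and $X(t)=(N(t),R(t))$, and let $\mathbb{F}=\{\mathcal{F}_t;t\ge0\}$ be a filtration such that $\sigma(\{X(u);u\le t\})\subset\mathcal{F}_t$ for all $t\ge0$. Assume that $X(0)=(1,T_1)$ (i.e. $t_0=0$), that $T_n>0$ almost surely and $\mathbb{E}[T_n]<\infty$ for all $n\ge1$, that for each $n\ge1$ the variable $T_n$ is independent of $\mathcal{F}_{t_{n-1}-}$, and that $T_1,T_2,\ldots$ are identically distributed (so that $N(\cdot)$ is a renewal process). Let $\lambda=1/\mathbb{E}[T_1]$. Then $$N(t)=\lambda\big(t+R(t)\big)+M(t),\qquad t\ge0,$$ where $$M(t)=\sum_{n=1}^{N(t)}(1-\lambda T_n),\qquad t\ge0,$$ is an $\mathbb{F}$-martingale.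
   Context: A counting process $N(\cdot)=\{N(t);t\ge0\}$ is a non-negative integer-valued process such that $N(t)$ is finite, nondecreasing and right-continuous with left-hand limits, and $N(t)-N(t-)\le1$ for all $t\ge0$, where $N(0-)=0$. Its counting times are $t_{n-1}=\inf\{t\ge0;\,n\le N(t)\}$, $n\ge1$. Since $t_0=0$, we have $N(0)=1$, and $n\le N(t)$ if and only if $t_{n-1}\le t$. For $n\ge1$, $T_n=t_n-t_{n-1}$. The residual time to the next counting instant is $R(t)=\sum_{\ell=1}^{N(t)}T_\ell-t$ for $t\ge0$ (so $R(t)=t_n-t$ for $t_{n-1}\le t<t_n$, and $R(t_n)=T_{n+1}$). For an $\mathbb{F}$-stopping time $\tau$, $\mathcal{F}_{\tau-}=\sigma(\{A\cap\{t<\tau\};A\in\mathcal{F}_t,t\ge0\})$; in particular $\mathcal{F}_{t_0-}$ is trivial when $t_0=0$. Each $t_n$ is an $\mathbb{F}$-stopping time. *)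

(* Defs.v *)
From mathcomp Require Import all_boot all_order all_algebra.
From mathcomp Require Import all_classical all_reals all_analysis measurable_realfun.

Set Implicit Arguments.
Unset Strict Implicit.
Unset Printing Implicit Defensive.

Import Order.TTheory GRing.Theory Num.Theory.
Import numFieldNormedType.Exports.

Local Open Scope classical_set_scope.
Local Open Scope ring_scope.
Local Open Scope ereal_scope.

(* Processes are indexed by all of R; only their values at times t >= 0 are
   ever constrained or used. *)

(* f(t-), with f(0-) = 0. *)
Definition left_value (R : realType) (f : R -> nat) (t : R) : R :=
  if (t <= 0)%R then 0%R else lim (((f s)%:R%R : R) @[s --> t^'-]).

Definition counting_path (R : realType) (f : R -> nat) : Prop :=
  [/\ (forall s t : R, (0 <= s)%R -> (s <= t)%R -> (f s <= f t)%N),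
      (forall t : R, (0 <= t)%R ->
         ((f s)%:R%R : R) @[s --> t^'+] --> ((f t)%:R%R : R)),
      (forall t : R, (0 < t)%R ->
         cvg (((f s)%:R%R : R) @[s --> t^'-])) &
      (forall t : R, (0 <= t)%R -> ((f t)%:R - left_value f t <= 1)%R)].

Definition counting_process (R : realType) (Omega : Type)
    (N : R -> Omega -> nat) : Prop :=
  forall w, counting_path (fun t => N t w).

(* t_n, with inf of the empty set = +oo (N never reaches n + 1). *)
Definition counting_time (R : realType) (Omega : Type)
    (N : R -> Omega -> nat) (n : nat) (w : Omega) : \bar R :=
  ereal_inf [set t%:E | t in [set t : R | (0 <= t)%R /\ (n.+1 <= N t w)%N]].

(* T_n = t_n - t_{n-1}, used for n >= 1 only.  The junk value of +oo - +oo is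
   -oo, so T_n > 0 a.s. together with E[T_n] < +oo forces t_n < +oo a.s. *)
Definition interarrival (R : realType) (Omega : Type)
    (N : R -> Omega -> nat) (n : nat) (w : Omega) : \bar R :=
  counting_time N n w - counting_time N n.-1 w.

(* R(t): equal to +oo exactly when no counting time follows t. *)
Definition residual (R : realType) (Omega : Type)
    (N : R -> Omega -> nat) (t : R) (w : Omega) : \bar R :=
  (\sum_(1 <= l < (N t w).+1) interarrival N l w) - t%:E.

Definition state (R : realType) (Omega : Type)
    (N : R -> Omega -> nat) (t : R) (w : Omega) : nat * \bar R :=
  (N t w, residual N t w).

Definition compensated (R : realType) (Omega : Type)
    (N : R -> Omega -> nat) (lambda : R) (t : R) (w : Omega) : \bar R :=
  \sum_(1 <= n < (N t w).+1) (1 - lambda%:E * interarrival N n w).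

Definition sigma_of (Omega : Type) d' (T' : measurableType d')
    (Y : Omega -> T') : set_system Omega :=
  preimage_set_system setT Y measurable.

Definition history (R : realType) (Omega : Type) d' (T' : measurableType d')
    (X : R -> Omega -> T') (t : R) : set_system Omega :=
  <<s \bigcup_(u in [set u : R | (0 <= u <= t)%R]) sigma_of (X u) >>.

Definition filtration (R : realType) d (Omega : measurableType d)
    (F : R -> set_system Omega) : Prop :=
  (forall t : R, (0 <= t)%R -> sigma_algebra setT (F t) /\ F t `<=` measurable)
  /\ (forall s t : R, (0 <= s)%R -> (s <= t)%R -> F s `<=` F t).

(* F_{tau-} = sigma({A /\ {t < tau} ; A in F_t, t >= 0}) *)
Definition strict_past (R : realType) (Omega : Type)
    (F : R -> set_system Omega) (tau : Omega -> \bar R) : set_system Omega :=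
  <<s [set B | exists (t : R) (A : set Omega),
        [/\ (0 <= t)%R, F t A & B = A `&` [set w | t%:E < tau w]]] >>.

Definition independent_of (R : realType) d (Omega : measurableType d)
    (P : probability Omega R) d' (T' : measurableType d')
    (Y : Omega -> T') (G : set_system Omega) : Prop :=
  forall A B, sigma_of Y A -> G B -> P (A `&` B) = P A * P B.

Definition same_law (R : realType) d (Omega : measurableType d)
    (P : probability Omega R) d' (T' : measurableType d')
    (Y Z : Omega -> T') : Prop :=
  forall B, measurable B -> pushforward P Y B = pushforward P Z B.

(* Z is a version of E[Y | G]; Y is integrable and G a sub-sigma-algebra
   wherever this is used. *)
Definition is_cond_exp (R : realType) d (Omega : measurableType d)
    (P : probability Omega R) (G : set_system Omega)
    (Y Z : Omega -> \bar R) : Prop :=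
  [/\ sigma_of Z `<=` G, P.-integrable setT Z &
      forall A, G A -> \int[P]_(w in A) Z w = \int[P]_(w in A) Y w].

Definition martingale (R : realType) d (Omega : measurableType d)
    (P : probability Omega R) (F : R -> set_system Omega)
    (M : R -> Omega -> \bar R) : Prop :=
  [/\ (forall t : R, (0 <= t)%R -> sigma_of (M t) `<=` F t),
      (forall t : R, (0 <= t)%R -> P.-integrable setT (M t)) &
      (forall s t : R, (0 <= s)%R -> (s <= t)%R ->
         is_cond_exp P (F s) (M t) (M s))].

(* Main.v *)
(** On [{n <= N(t)}] the gap [T_n] is independent of that event, since
    [{n <= N(t)} = {t_{n-1} <= t}] belongs to the strict past of [t_{n-1}];
    more generally this holds for [A] in [F_s] intersected with
    [{N(s) < n <= N(t)}]. Summing over [n] gives Wald's identity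
    [E[1_A sum_{N(s) < n <= N(t)} f(T_n)] = E[f(T_1)] E[1_A (N(t) - N(s))]].
    With [f(x) = min(x, 1)] and [A] everything, it yields [E[N(t)] < oo], the
    truncated gaps summing to at most [t + 1]; with [f(x) = x] it says that the
    increment of [N(t) - lambda (t + R(t))] over [(s, t]] integrates to [0]
    over [A]. By telescoping, [t + R(t)] is the next renewal time
    [t_{N(t)}] and [M(t) = N(t) - lambda t_{N(t)}], even where it is
    infinite. *)
Require Import Defs.
From mathcomp Require Import all_boot all_order all_algebra.
From mathcomp Require Import all_classical all_reals all_analysis measurable_realfun ring.

Import Order.TTheory GRing.Theory Num.Theory.
Import numFieldNormedType.Exports.

Local Open Scope classical_set_scope.
Local Open Scope ring_scope.
Local Open Scope ereal_scope.

Set Implicit Arguments.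
Unset Strict Implicit.

(** Counting times are indexed from 0 and t_n <= t iff [n < N t w], so index [N t w] designates the
    first one strictly after [t]. It stays in the extended reals, being [+oo] when the path never
    jumps again. *)
Definition next_time (R : realType) (Omega : Type) (N : R -> Omega -> nat)
  (t : R) (w : Omega) : \bar R := counting_time N (N t w) w.

(** * Pathwise identities for counting times, gaps and residual times *)

Section CountingPath.
Context (R : realType) (Omega : Type) (N : R -> Omega -> nat).
Hypothesis hN : counting_process N.

Local Notation c := (counting_time N).
Local Notation T := (interarrival N).

Lemma counting_time_ge0 n w : 0 <= c n w.
Proof. by apply: le_ereal_inf_tmp => _ [t [t0 _] <-]; rewrite lee_fin. Qed.

Lemma counting_time_leS n w : c n w <= c n.+1 w.
Proof.
apply: le_ereal_inf => _ [t [t0 tn] <-]; exists t => //; split => //.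
exact: leq_trans tn.
Qed.

Lemma counting_time_le a b w : (a <= b)%N -> c a w <= c b w.
Proof.
move=> /subnK<-; elim: (b - a)%N => [//|k IHk].
by rewrite addSn (le_trans IHk)// counting_time_leS.
Qed.

(** Right-continuity makes the infimum attained: if N(t) <= n, the integer-valued path stays within
    distance less than 1 of N(t) just after t, so it cannot exceed n there and t_n > t. *)
Lemma counting_timeE n t w : (0 <= t)%R -> (c n w <= t%:E) = (n < N t w)%N.
Proof.
move=> t0; apply/idP/idP => [|tn]; last first.
  by apply: ereal_inf_lbound; exists t.
apply: contraTT; rewrite -leqNgt -ltNge => Ntn.
have [mono rc _ _] := hN w.
have : \forall s \near t^'+, (`|((N s w)%:R : R) - (N t w)%:R| < 1)%R.
  have /cvgrPdist_lt/(_ 1%R ltr01) := rc _ t0.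
  by apply: filterS => s; rewrite distrC.
move=> [e /= e0 He].
(* A point strictly inside the radius [e] is a lower bound of the whole set, so the inequality stays
   strict after taking the infimum. *)
apply: (@lt_le_trans _ _ (t + e / 2)%:E).
  by rewrite lte_fin ltrDl divr_gt0.
apply: le_ereal_inf_tmp => _ [s [s0 sn] <-]; rewrite lee_fin leNgt.
apply/negP => ste.
have ts : (t < s)%R.
  rewrite ltNge; apply/negP => st.
  by have := leq_trans sn (leq_trans (mono _ _ s0 st) Ntn); rewrite ltnn.
have /He /(_ ts) : ball t e s.
  rewrite /ball /= ltr0_norm ?subr_lt0// opprB ltrBlDl.
  by rewrite (lt_trans ste)// ltrD2l ltr_pdivrMr// ltr_pMr// ltr1n.
have NN := leq_ltn_trans Ntn sn.
rewrite ger0_norm ?subr_ge0 ?ler_nat 1?ltnW// ltrBlDr addrC natr1.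
by rewrite ltr_nat ltnNge NN.
Qed.

Lemma counting_time_fin n t w :
  (0 <= t)%R -> (n < N t w)%N -> c n w \is a fin_num.
Proof.
move=> t0; rewrite -counting_timeE// => ct.
by rewrite ge0_fin_numE ?counting_time_ge0// (le_lt_trans ct)// ltry.
Qed.

(** The bound [n < N t w] makes t_n finite, which excludes the junk difference [+oo - +oo = -oo]. *)
Lemma interarrival_ge0 n t w :
  (0 <= t)%R -> (n < N t w)%N -> 0 <= T n.+1 w.
Proof.
move=> t0 nt; rewrite /interarrival /= sube_ge0 ?counting_time_leS//.
by rewrite (counting_time_fin t0 nt).
Qed.

(** Telescoping: every subtracted time has index below N(t), hence is finite. Only the last one,
    [c b w], may be infinite, when [b = N t w]. *)
Lemma sum_interarrival a b t w : (0 <= t)%R -> (a <= b)%N -> (b <= N t w)%N ->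
  c a w + \sum_(a <= n < b) T n.+1 w = c b w.
Proof.
move=> t0; elim: b => [|b IHb].
  by rewrite leqn0 => /eqP->; rewrite big_geq// adde0.
rewrite leq_eqVlt => /predU1P[->|ab] bt; first by rewrite big_geq// adde0.
rewrite big_nat_recr//= addeA IHb ?(ltnW bt)// /interarrival /= addeC subeK//.
exact: counting_time_fin bt.
Qed.

Hypothesis N0 : forall w, N 0%R w = 1%N.

Lemma counting_time0 w : c 0%N w = 0.
Proof.
by apply/eqP; rewrite eq_le counting_time_ge0 counting_timeE// N0.
Qed.

Lemma sum0_interarrival b t w : (0 <= t)%R -> (b <= N t w)%N ->
  \sum_(1 <= n < b.+1) T n w = c b w.
Proof.
move=> t0 bt; rewrite big_add1 /= -(@sum_interarrival 0 b t w)//.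
by rewrite counting_time0 add0e.
Qed.

Lemma residualE t w : (0 <= t)%R -> residual N t w = next_time N t w - t%:E.
Proof. by move=> t0; rewrite /residual (@sum0_interarrival _ t). Qed.

Lemma next_timeE t w : (0 <= t)%R ->
  next_time N t w = t%:E + residual N t w.
Proof. by move=> t0; rewrite residualE// addeC subeK. Qed.

Lemma compensatedE lambda t w : (0 < lambda)%R -> (0 <= t)%R ->
  compensated N lambda t w = (N t w)%:R%:E - lambda%:E * next_time N t w.
Proof.
move=> l0 t0; rewrite /next_time /compensated big_add1 /=.
have: (N t w <= N t w)%N by [].
move: {1 3 4 5}(N t w) => b; elim: b => [|b IHb] bt.
  by rewrite big_geq// counting_time0 mule0 sube0.
rewrite big_nat_recr//= IHb 1?ltnW// /interarrival /=.
have := counting_time_fin t0 bt; have := counting_time_ge0 b.+1 w.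
case: (c b w) => [x| |]// + _; case: (c b.+1 w) => [y| |]//= _.
  rewrite -!(EFinM, EFinN, EFinB, EFinD); congr EFin; rewrite -natr1; ring.
(* Here t_{N(t)} is [+oo]; as [0 < lambda], so is its multiple, and both sides equal [-oo]. *)
by rewrite !gt0_muley ?lte_fin.
Qed.

(** The last gap may overshoot t, but its truncation is at most 1. The other gaps telescope to at
    most t_{N(t)-1} <= t. *)
Lemma sum_mine_interarrival_le a t w : (0 <= t)%R ->
  \sum_(a <= n < N t w) mine (T n.+1 w) 1 <= t%:E + 1.
Proof.
move=> t0; case: (ltnP a (N t w)) => [aN|Na]; last first.
  by rewrite big_geq// -EFinD lee_fin addr_ge0.
case E : (N t w) aN => [//|k] ak; have kt : (k < N t w)%N by rewrite E.
rewrite big_nat_recr//= leeD ?ge_min ?lexx ?orbT//.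
apply: (@le_trans _ _ (c a w + \sum_(a <= n < k) T n.+1 w)).
  rewrite -[leLHS]add0e leeD ?counting_time_ge0// lee_sum// => i _.
  by rewrite ge_min lexx.
by rewrite (@sum_interarrival _ _ t)// 1?ltnW// counting_timeE.
Qed.

End CountingPath.

(** * Integrals under independence and under equality in law *)

Section Independence.
Context d (Omega : measurableType d) (R : realType) (P : probability Omega R).

Lemma ge0_integral_mrestr (B : set Omega) (mB : measurable B)
    (g : Omega -> \bar R) :
  measurable_fun setT g -> (forall w, 0 <= g w) ->
  \int[mrestr P mB]_w g w = \int[P]_(w in B) g w.
Proof.
move=> mg g0; rewrite (ge0_negligible_integral (measurableC mB))//; last first.
  by rewrite /= /mrestr setICl measure0.
rewrite setDE setCK setTI; apply: eq_measure_integral => A mA AB.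
by rewrite /= /mrestr; congr (P _); apply/setIidPl.
Qed.

(** Independence says that the image under [Y] of [P] restricted to [B] is [P B] times the law of
    [Y]; then [f] is integrated against both measures. *)
Lemma integral_independent d' (S : measurableType d') (Y : Omega -> S)
    (G : set_system Omega) (B : set Omega) (f : S -> \bar R) :
  measurable_fun setT Y -> independent_of P Y G -> G B -> measurable B ->
  measurable_fun setT f -> (forall x, 0 <= f x) ->
  \int[P]_(w in B) f (Y w) = P B * \int[P]_w f (Y w).
Proof.
move=> mY YG GB mB mf f0.
have mfY : measurable_fun setT (f \o Y) by exact: measurableT_comp.
have k0 : (0 <= fine (P B))%R by rewrite fine_ge0.
rewrite -(ge0_integral_mrestr mB mfY)//=.
rewrite -[LHS](@ge0_integral_pushforward _ _ _ _ _ _ mY (mrestr P mB) setT f)//.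
rewrite -[X in _ * X](@ge0_integral_pushforward _ _ _ _ _ _ mY P setT f)//.
rewrite -[P B]fineK ?fin_num_measure//.
rewrite -(@ge0_integral_mscale _ _ _ _ _ measurableT (NngNum k0))//.
apply: eq_measure_integral => A mA _.
rewrite /= /pushforward /mscale /= /mrestr fineK ?fin_num_measure// muleC.
by apply: YG => //; exists A => //; rewrite setTI.
Qed.

Lemma integral_same_law d' (S : measurableType d') (Y Z : Omega -> S)
    (f : S -> \bar R) :
  measurable_fun setT Y -> measurable_fun setT Z -> same_law P Y Z ->
  measurable_fun setT f -> (forall x, 0 <= f x) ->
  \int[P]_w f (Y w) = \int[P]_w f (Z w).
Proof.
move=> mY mZ YZ mf f0.
rewrite -[LHS](@ge0_integral_pushforward _ _ _ _ _ _ mY P setT f)//.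
rewrite -[RHS](@ge0_integral_pushforward _ _ _ _ _ _ mZ P setT f)//.
by apply: eq_measure_integral => A mA _; exact: YZ.
Qed.

End Independence.

(** * Measurability of counts, counting times and gaps *)

Section Renewal.
Context (R : realType) d (Omega : measurableType d) (P : probability Omega R)
  (N : R -> Omega -> nat) (F : R -> set_system Omega).
Hypothesis hN : counting_process N.
Hypothesis hF : filtration F.
Hypothesis hX : forall t : R, (0 <= t)%R -> history (state N) t `<=` F t.
Hypothesis N0 : forall w, N 0%R w = 1%N.

Local Notation c := (counting_time N).
Local Notation T := (interarrival N).

Lemma state_adapted t B : (0 <= t)%R -> measurable B ->
  F t (state N t @^-1` B).
Proof.
move=> t0 mB; apply: (hX t0); apply: sub_sigma_algebra.
by exists t => /=; [rewrite t0 lexx | exists B => //; rewrite setTI].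
Qed.

Lemma count_adapted t (B : set nat) : (0 <= t)%R -> F t (N t @^-1` B).
Proof.
move=> t0; rewrite (_ : _ @^-1` _ = state N t @^-1` (B `*` setT)).
  by apply: state_adapted => //; exact: measurableX.
by apply/seteqP; split => w //= [].
Qed.

Lemma filtration_measurable t A : (0 <= t)%R -> F t A -> measurable A.
Proof. by move=> t0; apply: (hF.1 t t0).2. Qed.

Lemma measurable_count t : (0 <= t)%R -> measurable_fun setT (N t).
Proof.
move=> t0 _ B _; rewrite setTI.
exact: filtration_measurable (count_adapted B t0).
Qed.

Lemma measurable_count_EFin t : (0 <= t)%R ->
  measurable_fun setT (fun w => (N t w)%:R%:E : \bar R).
Proof.
move=> t0.
apply: (@measurableT_comp _ _ _ _ _ _ (fun n : nat => n%:R%:E : \bar R)) => //.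
exact: measurable_count.
Qed.

Lemma measurable_counting_time n : measurable_fun setT (c n).
Proof.
apply: (measurability _ (ErealGenOInfty.measurableE R)) => _ [_ [r ->] <-].
rewrite setTI; have [r0|r0] := leP 0%R r.
  rewrite (_ : _ @^-1` _ = N r @^-1` [set k | (k <= n)%N]).
    exact: filtration_measurable (count_adapted _ r0).
  by apply/seteqP; split => w /=;
    rewrite in_itv/= andbT ltNge counting_timeE// -leqNgt.
(* For [r < 0] the ray contains every value, counting times being nonnegative. *)
rewrite (_ : _ @^-1` _ = setT)//; apply/seteqP; split => w //= _.
by rewrite in_itv/= andbT (@lt_le_trans _ _ 0)// counting_time_ge0.
Qed.

Lemma measurable_interarrival n : measurable_fun setT (T n).
Proof. by apply: emeasurable_funB; exact: measurable_counting_time. Qed.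

(** Used with random bounds: they move into an indicator within a series over all n, which can be
    integrated term by term. *)
Lemma nneseries_nat (g : nat -> \bar R) a b :
  (forall n, 0 <= g n) ->
  \sum_(a <= n < b) g n = \sum_(0 <= n <oo) if (a <= n < b)%N then g n else 0.
Proof.
move=> g0; rewrite (@nneseries_split _ _ 0 b); last first.
  by move=> k _; case: ifP.
rewrite add0n [X in _ = _ + X]eseries0 ?adde0; last first.
  by move=> i bi _; rewrite (ltnNge i) bi andbF.
rewrite -big_mkcond (@big_nat_widenl _ _ _ a 0)// [RHS]big_nat_cond.
rewrite [LHS]big_nat_cond; apply: eq_bigl => i /=.
by case: (i < b)%N; rewrite ?andbT ?andbF.
Qed.

(** * Wald's identity *)

Hypothesis hTindep : forall n, (1 <= n)%N ->
  independent_of P (T n) (strict_past F (c n.-1)).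
Hypothesis hTid : forall n, (1 <= n)%N -> same_law P (T n) (T 1%N).

(** The event {N(s) <= n < N(t)} is {s < t_n <= t}. Thus the set is the generator A with {s < t_n},
    minus the generator {t < t_n} built on the full set. The gap that starts at t_n is T_{n+1}. *)
Lemma strict_past_count s t A n : (0 <= s)%R -> (s <= t)%R -> F s A ->
  strict_past F (c n) (A `&` [set w | (N s w <= n < N t w)%N]).
Proof.
move=> s0 st sA; have t0 := le_trans s0 st.
have FT : F t setT.
  by have := count_adapted setT t0; rewrite preimage_setT.
rewrite (_ : _ `&` _ = (A `&` [set w | s%:E < c n w]) `&`
    ~` (setT `&` [set w | t%:E < c n w])); last first.
  apply/seteqP; split => w /=; rewrite !ltNge !counting_timeE// -leqNgt.
    by move=> [Aw /andP[-> ->]]; split => // -[].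
  by move=> [[Aw ->] tn]; split => //; apply/negPn/negP => ?; apply: tn.
have SA : sigma_algebra setT (strict_past F (c n)).
  exact: smallest_sigma_algebra.
have [|_ _ _ SI] := (sigma_algebraP _).1 SA; first by move=> ? _.
apply: SI.
- by apply: sub_sigma_algebra; exists s, A.
- case: SA => _ SC _; rewrite -setTD; apply: SC.
  by apply: sub_sigma_algebra; exists t, setT.
Qed.

Lemma measurable_count_between s t n : (0 <= s)%R -> (0 <= t)%R ->
  measurable [set w | (N s w <= n < N t w)%N].
Proof.
move=> s0 t0; rewrite (_ : [set w | _] = N s @^-1` [set k | (k <= n)%N] `&`
                             N t @^-1` [set k | (n < k)%N]).
  by apply: measurableI; [exact: filtration_measurable (count_adapted _ s0) |
    exact: filtration_measurable (count_adapted _ t0)].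
by apply/seteqP; split => w /=; [move=> /andP[] | move=> [-> ->]].
Qed.

Lemma sum_interarrival_nneseries s t (f : \bar R -> \bar R) w :
  (forall x : \bar R, 0 <= f x) ->
  \sum_(N s w <= n < N t w) f (T n.+1 w) =
  \sum_(0 <= n <oo)
     ((fun w => f (T n.+1 w)) \_ [set w | (N s w <= n < N t w)%N]) w.
Proof.
move=> f0; rewrite nneseries_nat//; apply: eq_eseriesr => n _; rewrite patchE.
by case: ifPn => /= [H|/negP H]; [rewrite mem_set | rewrite memNset].
Qed.

Lemma measurable_interarrival_between s t n (f : \bar R -> \bar R) :
  (0 <= s)%R -> (0 <= t)%R -> measurable_fun setT f ->
  measurable_fun setT
    ((fun w => f (T n.+1 w)) \_ [set w | (N s w <= n < N t w)%N]).
Proof.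
move=> s0 t0 mf.
apply/(measurable_restrictT _ _).1; first exact: measurable_count_between.
apply: measurable_funTS; apply: measurableT_comp => //.
exact: measurable_interarrival.
Qed.

Lemma measurable_sum_interarrival s t (f : \bar R -> \bar R) :
  (0 <= s)%R -> (0 <= t)%R ->
  measurable_fun setT f -> (forall x : \bar R, 0 <= f x) ->
  measurable_fun setT (fun w => \sum_(N s w <= n < N t w) f (T n.+1 w)).
Proof.
move=> s0 t0 mf f0; under eq_fun do rewrite sum_interarrival_nneseries//.
apply: ge0_emeasurable_sum => n; last first.
  by move=> _; exact: measurable_interarrival_between.
by move=> w _ _; exact: erestrict_ge0.
Qed.

Lemma wald_series s t A (f : \bar R -> \bar R) :
  (0 <= s)%R -> (s <= t)%R -> F s A ->
  measurable_fun setT f -> (forall x : \bar R, 0 <= f x) ->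
  \int[P]_(w in A) (\sum_(N s w <= n < N t w) f (T n.+1 w)) =
  \sum_(0 <= n <oo) (P (A `&` [set w | (N s w <= n < N t w)%N]) *
                     \int[P]_w f (T 1%N w)).
Proof.
move=> s0 st sA mf f0; have t0 := le_trans s0 st.
have mA := filtration_measurable s0 sA.
have mfT n : measurable_fun setT (fun w => f (T n w)).
  by apply: measurableT_comp => //; exact: measurable_interarrival.
under eq_integral do rewrite sum_interarrival_nneseries//.
rewrite integral_nneseries//; last 2 first.
- by move=> n; apply: measurable_funTS; exact: measurable_interarrival_between.
- by move=> n w _; exact: erestrict_ge0.
apply: eq_eseriesr => n _; rewrite -integral_mkcondr.
rewrite (integral_independent (G := strict_past F (c n)) (Y := T n.+1))//.
- congr (_ * _).
  by apply: integral_same_law => //;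
    [exact: measurable_interarrival..|exact: hTid].
- exact: measurable_interarrival.
- exact: hTindep n.+1 _.
- exact: strict_past_count.
- by apply: measurableI => //; exact: measurable_count_between.
Qed.

Lemma wald s t A (f : \bar R -> \bar R) :
  (0 <= s)%R -> (s <= t)%R -> F s A ->
  measurable_fun setT f -> (forall x : \bar R, 0 <= f x) ->
  \int[P]_w f (T 1%N w) < +oo ->
  \int[P]_(w in A) (\sum_(N s w <= n < N t w) f (T n.+1 w)) =
  \int[P]_w f (T 1%N w) * \int[P]_(w in A) (N t w - N s w)%:R%:E.
Proof.
move=> s0 st sA mf f0 foo.
have f_fin : \int[P]_w f (T 1%N w) \is a fin_num.
  by rewrite ge0_fin_numE// integral_ge0.
rewrite wald_series// -(fineK f_fin).
under eq_eseriesr do rewrite muleC.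
rewrite nneseriesZl//; congr (_ * _).
(* The constant function 1 in [wald_series] identifies the remaining series of probabilities with
   the integral of N(t) - N(s) over [A]. *)
have P1 : \int[P]_w cst 1 (T 1%N w) = 1.
  by rewrite integral_cst// mul1e; exact: probability_setT.
have := wald_series s0 st sA (measurable_cst (1 : \bar R)) (fun=> lee01).
under [in X in _ = X -> _]eq_eseriesr do rewrite P1 mule1.
by move=> <-; apply: eq_integral => w _; rewrite /= sumEFin sumr_const_nat.
Qed.

(** * Finite means of the count and of the next renewal time *)

Hypothesis T1_gt0 : {ae P, forall w, 0 < T 1%N w}.
Hypothesis T1_lty : \int[P]_w T 1%N w < +oo.

Local Notation m := (\int[P]_w T 1%N w).
Local Notation S := (next_time N).

Lemma interarrival1_ge0 w : 0 <= T 1%N w.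
Proof. by apply: (interarrival_ge0 hN (lexx 0%R)); rewrite N0. Qed.

(** A zero integral would make [g] vanish almost everywhere while being positive almost everywhere,
    which is impossible under a probability. *)
Lemma ae_gt0_integral_gt0 (g : Omega -> \bar R) : measurable_fun setT g ->
  (forall w, 0 <= g w) -> {ae P, forall w, 0 < g w} -> 0 < \int[P]_w g w.
Proof.
move=> mg g0 gpos; rewrite lt_neqAle integral_ge0// andbT eq_sym.
apply/eqP => g_eq0.
have /(ae_eq_integral_abs P measurableT mg) g_ae0 : \int[P]_w `|g w| = 0.
  by under eq_integral do rewrite gee0_abs//.
have P0 : 0 < P setT by rewrite probability_setT.
have [w [/(_ I) -> ]] := @filter_ex _ _ (ae_properfilter_algebraOfSetsType P0) _
  (filterI g_ae0 gpos).
by rewrite /= ltxx.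
Qed.

Lemma mean_gt0 : 0 < m.
Proof.
apply: ae_gt0_integral_gt0 => //; first exact: measurable_interarrival.
exact: interarrival1_ge0.
Qed.

Lemma mean_fin : m \is a fin_num.
Proof. by rewrite gt0_fin_numE// mean_gt0. Qed.

Lemma count_le s t w : (0 <= s)%R -> (s <= t)%R -> (N s w <= N t w)%N.
Proof. by have [+ _ _ _] := hN w; apply. Qed.

Lemma filtration_setT t : (0 <= t)%R -> F t setT.
Proof. by move=> t0; have := count_adapted setT t0; rewrite preimage_setT. Qed.

Lemma measurable_residual t : (0 <= t)%R -> measurable_fun setT (residual N t).
Proof.
move=> t0; apply: (@measurableT_comp _ _ _ _ _ _ snd _ (state N t)) => //.
move=> _ B mB; rewrite setTI.
exact: filtration_measurable (state_adapted t0 mB).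
Qed.

Lemma measurable_next_time t : (0 <= t)%R -> measurable_fun setT (S t).
Proof.
move=> t0; rewrite (_ : S t = fun w => t%:E + residual N t w); last first.
  by apply/funext => w; rewrite next_timeE.
by apply: emeasurable_funD => //; exact: measurable_residual.
Qed.

Lemma measurable_count_incr s t : (0 <= s)%R -> (s <= t)%R ->
  measurable_fun setT (fun w => (N t w - N s w)%:R%:E : \bar R).
Proof.
move=> s0 st; have t0 := le_trans s0 st.
rewrite (_ : (fun w => _) = fun w => (N t w)%:R%:E - (N s w)%:R%:E).
  by apply: emeasurable_funB; exact: measurable_count_EFin.
by apply/funext => w; rewrite -EFinB -natrB// count_le.
Qed.

Lemma integral_count s t A : (0 <= s)%R -> (s <= t)%R -> F s A ->
  \int[P]_(w in A) (N t w)%:R%:E = \int[P]_(w in A) (N s w)%:R%:E +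
    \int[P]_(w in A) (N t w - N s w)%:R%:E.
Proof.
move=> s0 st sA; have t0 := le_trans s0 st.
rewrite -ge0_integralD//.
- apply: eq_integral => w _; rewrite -EFinD -natrD subnKC//.
  exact: count_le.
- exact: filtration_measurable sA.
- by apply: measurable_funTS; exact: measurable_count_EFin.
- by apply: measurable_funTS; exact: measurable_count_incr.
Qed.

Lemma integral_next_time s t A : (0 <= s)%R -> (s <= t)%R -> F s A ->
  \int[P]_(w in A) S t w = \int[P]_(w in A) S s w +
    m * \int[P]_(w in A) (N t w - N s w)%:R%:E.
Proof.
move=> s0 st sA; have t0 := le_trans s0 st.
(* [wald] asks for a function nonnegative on all of [\bar R]; the positive part agrees with the
   identity on the gaps that occur in the sum. *)
pose f (x : \bar R) := maxe x 0.
have mf : measurable_fun setT f by apply: measurable_maxe.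
have f0 x : 0 <= f x by rewrite le_max lexx orbT.
have fT1 w : f (T 1%N w) = T 1%N w.
  by apply/max_idPl; exact: interarrival1_ge0.
have mE : \int[P]_w f (T 1%N w) = m by apply: eq_integral => w _.
rewrite -mE -(wald s0 st sA mf f0) ?mE// -ge0_integralD//.
- apply: eq_integral => w _.
  rewrite /next_time -(sum_interarrival hN t0 (count_le w s0 st) (leqnn _)).
  congr (_ + _); apply: eq_big_nat => n /andP[_ nt].
  by apply/esym/max_idPl; exact: interarrival_ge0 nt.
- exact: filtration_measurable sA.
- by move=> w _; exact: counting_time_ge0.
- by apply: measurable_funTS; exact: measurable_next_time.
- by move=> w _; apply: sume_ge0.
- by apply: measurable_funTS; exact: measurable_sum_interarrival.
Qed.

(* Wald's identity for the truncated gaps [min(T_n, 1)], whose sum over the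
   renewals up to [t] is at most [t + 1], bounds the mean number of renewals. *)
Lemma integral_count_incr_lty t : (0 <= t)%R ->
  \int[P]_w (N t w - N 0%R w)%:R%:E < +oo.
Proof.
move=> t0.
pose f (x : \bar R) := maxe (mine x 1) 0.
have mf : measurable_fun setT f.
  by apply: measurable_maxe => //; apply: measurable_mine.
have f0 x : 0 <= f x by rewrite le_max lexx orbT.
have mfT n : measurable_fun setT (fun w => f (T n w)).
  by apply: measurableT_comp => //; exact: measurable_interarrival.
have f_gt0 : 0 < \int[P]_w f (T 1%N w).
  apply: ae_gt0_integral_gt0 => //; apply: filterS T1_gt0 => w w0.
  by rewrite lt_max lt_min w0 lte01.
have f_lty : \int[P]_w f (T 1%N w) < +oo.
  apply: (@le_lt_trans _ _ (\int[P]_w cst 1 w)).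
    by apply: ge0_le_integral => // w _; rewrite ge_max ge_min lexx orbT lee01.
  rewrite integral_cst// mul1e.
  by apply: (le_lt_trans (probability_le1 P _)) => //; rewrite ltry.
have := wald (lexx 0%R) t0 (filtration_setT (lexx 0%R)) mf f0 f_lty.
set I := \int[P]_w _%:R%:E => W.
have I0 : 0 <= I by exact: integral_ge0.
have : \int[P]_w f (T 1%N w) * I <= t%:E + 1.
  rewrite -W; apply: (@le_trans _ _ (\int[P]_w cst (t%:E + 1) w)); last first.
    rewrite integral_cst// [X in _ * X](_ : _ = 1) ?mule1//.
    exact: probability_setT.
  apply: ge0_le_integral => //.
  - by move=> w _; apply: sume_ge0.
  - exact: measurable_sum_interarrival.
  - move=> w _; apply: le_trans (sum_mine_interarrival_le hN (N 0%R w) w t0).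
    rewrite big_nat_cond [leRHS]big_nat_cond.
    apply: lee_sum => n /andP[/andP[_ nt] _].
    rewrite ge_max lexx le_min lee01 andbT.
    exact: interarrival_ge0 nt.
(* If [I] were [+oo], its product with the positive mean of [f] would be [+oo], against the bound t
   + 1. *)
case: I I0 {W} => [r| |]//= _; first by rewrite ltry.
by rewrite gt0_muley// leye_eq.
Qed.

Lemma integrable_count t : (0 <= t)%R ->
  P.-integrable setT (fun w => (N t w)%:R%:E).
Proof.
move=> t0; apply/integrableP; split; first exact: measurable_count_EFin.
under eq_integral do rewrite gee0_abs//.
rewrite (integral_count (lexx _) t0 (filtration_setT (lexx _))).
rewrite lte_add_pinfty ?integral_count_incr_lty//.
under eq_integral do rewrite N0.
rewrite integral_cst// mul1e.
by apply: (le_lt_trans (probability_le1 P _)) => //; rewrite ltry.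
Qed.

(** Starting from time 0, where the next renewal time is T_1, its mean is E[T_1] plus E[T_1] times
    the finite mean increment of the count. *)
Lemma integrable_next_time t : (0 <= t)%R -> P.-integrable setT (S t).
Proof.
move=> t0; apply/integrableP; split; first exact: measurable_next_time.
under eq_integral do rewrite gee0_abs ?counting_time_ge0//.
rewrite (integral_next_time (lexx _) t0 (filtration_setT (lexx _))).
have S0 w : S 0%R w = T 1%N w.
  by rewrite /next_time N0 /interarrival /= (counting_time0 hN N0) sube0.
rewrite lte_add_pinfty//; first by under eq_integral do rewrite S0.
rewrite lte_mul_pinfty ?mean_fin//; first exact/ltW/mean_gt0.
exact: integral_count_incr_lty.
Qed.

(** Integrability gives a null set for each fixed time; integer times leave countably many, and
    monotonicity of t_{N(t)} in t covers all the others. *)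
Lemma residual_lty_ae :
  {ae P, forall w, forall t : R, (0 <= t)%R -> residual N t w < +oo}.
Proof.
have : {ae P, forall w (k : nat), S k%:R%R w \is a fin_num}.
  apply: ae_foralln => k.
  have := integrable_ae measurableT (integrable_next_time (ler0n R k)).
  by apply: filterS => w /(_ I).
apply: filterS => w Sfin t t0; rewrite residualE//.
have tk : (t <= (Num.bound t)%:R)%R by rewrite ltW// archi_boundP.
have Sk : S t w <= S (Num.bound t)%:R%R w.
  by apply: counting_time_le; exact: count_le.
by rewrite lteBlDr// (le_lt_trans Sk)// addye// ltey_eq Sfin.
Qed.

(** * The martingale property *)

Variable lambda : R.
Hypothesis lambdaE : lambda = (1 / fine m)%R.

Lemma lambda_gt0 : (0 < lambda)%R.
Proof. by rewrite lambdaE divr_gt0// fine_gt0// mean_gt0 T1_lty. Qed.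

Lemma lambda_mean : lambda%:E * m = 1.
Proof.
have m0 : (0 < fine m)%R by rewrite fine_gt0// mean_gt0 T1_lty.
by rewrite lambdaE -[X in _ * X](fineK mean_fin) -EFinM divfK// gt_eqF.
Qed.

Lemma compensated_adapted t : (0 <= t)%R ->
  sigma_of (compensated N lambda t) `<=` F t.
Proof.
move=> t0 _ [B mB <-]; rewrite setTI.
(* M(t) is a measurable function of the state (N(t), R(t)), so it inherits adaptedness from it. *)
pose g (x : nat * \bar R) := x.1%:R%:E - lambda%:E * (t%:E + x.2).
have mg : measurable_fun setT g.
  apply: emeasurable_funB.
    exact: (@measurableT_comp _ _ _ _ _ _ (fun n : nat => n%:R%:E : \bar R)).
  by apply: measurable_funeM; apply: emeasurable_funD.
rewrite (_ : _ @^-1` B = state N t @^-1` (g @^-1` B)).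
  by apply: state_adapted => //; rewrite -[X in measurable X]setTI; exact: mg.
by apply/seteqP; split => w /=; rewrite compensatedE ?lambda_gt0// next_timeE.
Qed.

Lemma integrable_compensated t : (0 <= t)%R ->
  P.-integrable setT (compensated N lambda t).
Proof.
move=> t0.
rewrite (_ : compensated _ _ _ = fun w => (N t w)%:R%:E - lambda%:E * S t w).
  apply: integrableB => //; first exact: integrable_count.
  by apply: integrableZl => //; exact: integrable_next_time.
by apply/funext => w; rewrite compensatedE// lambda_gt0.
Qed.

Lemma integral_compensated t A : (0 <= t)%R -> measurable A ->
  \int[P]_(w in A) compensated N lambda t w =
  \int[P]_(w in A) (N t w)%:R%:E - lambda%:E * \int[P]_(w in A) S t w.
Proof.
move=> t0 mA.
have iN : P.-integrable A (fun w => (N t w)%:R%:E).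
  by apply: integrableS (integrable_count t0).
have iS : P.-integrable A (S t).
  by apply: integrableS (integrable_next_time t0).
rewrite -integralZl// -integralB//; last exact: integrableZl.
by apply: eq_integral => w _; rewrite compensatedE// lambda_gt0.
Qed.

Lemma compensated_martingale : martingale P F (compensated N lambda).
Proof.
split; [exact: compensated_adapted|exact: integrable_compensated|].
move=> s t s0 st; split;
  [exact: compensated_adapted|exact: integrable_compensated|move=> A sA].
have t0 := le_trans s0 st; have mA := filtration_measurable s0 sA.
rewrite !integral_compensated// (integral_count s0 st sA).
rewrite (integral_next_time s0 st sA).
(* Once the three integrals are known to be finite, the claim is an identity between real numbers:
   the count grows by x and the compensator by lambda E[T_1] x = x. *)
have := integrable_fin_num mA (integrableS measurableT mA (@subsetT _ _)
  (integrable_count s0)).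
have := integrable_fin_num mA (integrableS measurableT mA (@subsetT _ _)
  (integrable_next_time s0)).
have : \int[P]_(w in A) (N t w - N s w)%:R%:E \is a fin_num.
  have := integrable_fin_num mA (integrableS measurableT mA (@subsetT _ _)
    (integrable_count t0)).
  by rewrite (integral_count s0 st sA) fin_numD => /andP[].
move: (\int[P]_(w in A) (N t w - N s w)%:R%:E) => x.
move: (\int[P]_(w in A) S s w) => y; move: (\int[P]_(w in A) _) => z.
move=> xf yf zf; rewrite muleDr ?fin_num_adde_defr//.
rewrite muleA lambda_mean mul1e.
rewrite -(fineK xf) -(fineK yf) -(fineK zf).
rewrite -!(EFinM, EFinD, EFinN, EFinB); congr EFin; ring.
Qed.

End Renewal.

Unset Implicit Arguments.

Theorem theorem2p1 (R : realType) (d : measure_display)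
    (Omega : measurableType d) (P : probability Omega R)
    (N : R -> Omega -> nat) (F : R -> set_system Omega) (lambda : R)
    (hN : counting_process N)
    (hF : filtration F)
    (hX : forall t : R, (0 <= t)%R -> history (state N) t `<=` F t)
    (hX0 : forall w, state N 0%R w = (1%N, interarrival N 1 w))
    (hTpos : forall n : nat, (1 <= n)%N ->
       {ae P, forall w, 0 < interarrival N n w})
    (hTint : forall n : nat, (1 <= n)%N ->
       \int[P]_w interarrival N n w < +oo)
    (hTindep : forall n : nat, (1 <= n)%N ->
       independent_of P (interarrival N n)
         (strict_past F (counting_time N n.-1)))
    (hTid : forall n : nat, (1 <= n)%N ->
       same_law P (interarrival N n) (interarrival N 1))
    (hlambda : lambda = (1 / fine (\int[P]_w interarrival N 1 w))%R) :
  [/\ (forall (w : Omega) (t : R), (0 <= t)%R -> residual N t w < +oo ->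
         (N t w)%:R%:E
           = lambda%:E * (t%:E + residual N t w) + compensated N lambda t w),
      {ae P, forall w, forall t : R, (0 <= t)%R -> residual N t w < +oo} &
      martingale P F (compensated N lambda)].
Proof.
have N0 w : N 0%R w = 1%N by case: (hX0 w).
have T1_gt0 := hTpos 1%N isT; have T1_lty := hTint 1%N isT.
split.
- move=> w t t0 rlty.
  rewrite (compensatedE hN N0)//; last first.
    exact: (lambda_gt0 hN hF hX N0 T1_gt0 T1_lty hlambda).
  rewrite -(next_timeE hN N0)//.
  (* Finiteness is what allows lambda t_{N(t)} to cancel; otherwise the right-hand side would add
     [+oo] and [-oo]. *)
  have : next_time N t w \is a fin_num.
    rewrite ge0_fin_numE ?(counting_time_ge0)// (next_timeE hN N0)//.
    by rewrite lte_add_pinfty ?ltry.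
  by move=> /fineK <-; rewrite -!(EFinM, EFinN, EFinD); congr EFin; ring.
- exact: (residual_lty_ae hN hF hX N0 hTindep hTid T1_gt0 T1_lty).
- exact: (compensated_martingale hN hF hX N0 hTindep hTid T1_gt0 T1_lty hlambda).
Qed.
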